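(* Let $(\mathfrak g,\lhd,\mathfrak a)$ be a right Lie module over a field of characteristic zero and let $\{\mathbf s,\mathbf t\}$, $\mathbf s,\mathbf t\colon\mathfrak g\to\mathfrak a$, be a matching Lie $\mathcal O$-operator on it. Let $[\mathbf s]$, $[\mathbf t]$, $[\mathbf s+\mathbf t]\colon\mathcal U(\mathfrak g)\to\mathcal U(\mathfrak a)$ be the Hopf $\mathcal O$-operators extending the Lie $\mathcal O$-operators $\mathbf s$, $\mathbf t$, $\mathbf s+\mathbf t$. Then $$[\mathbf s+\mathbf t]=[\mathbf s]\#[\mathbf t]=[\mathbf t]\#[\mathbf s].$$
   Context: A right Lie module $(\mathfrak g,\lhd,\mathfrak a)$: Lie algebras $\mathfrak g,\mathfrak a$ and a bilinear map $\lhd\colon\mathfrak g\times\mathfrak a\to\mathfrak g$ with $[x,y]\lhd a=[x\lhd a,y]+[x,y\lhd a]$ and $x\lhd[a,b]=(x\lhd a)\lhd b-(x\lhd b)\lhd a$. The action extends uniquely to a right action $\lhd$ of the algebra $\mathcal U(\mathfrak a)$ on $\mathcal U(\mathfrak g)$ such that each $a\in\mathfrak a$ acts by the derivation extending $x\mapsto x\lhd a$; then $(XY)\lhd A=(X\lhd A_{(1)})(Y\lhd A_{(2)})$ and $\lhd$ is a coalgebra map. Enveloping algebras carry their standard cocommutative Hopf structure; Sweedler notation is used, $\mathcal S$ is the antipode. A Lie $\mathcal O$-operator is a linear map $\mathbf t\colon\mathfrak g\to\mathfrak a$ with $[\mathbf t(x),\mathbf t(y)]_{\mathfrak a}=\mathbf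 t(x\lhd\mathbf t(y))-\mathbf t(y\lhd\mathbf t(x))+\mathbf t([x,y]_{\mathfrak g})$. A matching Lie $\mathcal O$-operator $\{\mathbf s,\mathbf t\}$ is a pair of Lie $\mathcal O$-operators with $[\mathbf s(x),\mathbf t(y)]_{\mathfrak a}=\mathbf s(x\lhd\mathbf t(y))-\mathbf t(y\lhd\mathbf s(x))$ for all $x,y\in\mathfrak g$; then $\mathbf s+\mathbf t$ is again a Lie $\mathcal O$-operator. A Hopf $\mathcal O$-operator is a coalgebra map $\mathbf T\colon\mathcal U(\mathfrak g)\to\mathcal U(\mathfrak a)$ (preserving counits) with $\mathbf T(e)\mathbf T(f)=\mathbf T\big((e\lhd\mathbf T(f_{(1)}))f_{(2)}\big)$. Each Lie $\mathcal O$-operator $\mathbf t$ extends uniquely to a Hopf $\mathcal O$-operator $[\mathbf t]$, given by the recursion $[\mathbf t](1)=1$, $[\mathbf t](h)=\mathbf t(h)$, $[\mathbf t](Eh)=[\mathbf t](E)\mathbf t(h)-[\mathbf t](E\lhd\mathbf t(h))$ for $h\in\mathfrak g$, $E\in\mathcal U(\mathfrak g)$. For linear maps $A,B\colon\mathcal U(\mathfrak g)\to\mathcal U(\mathfrak a)$, $(A\#B)(f)=A\big(f_{(1)}\lhd\mathcal S_{\mathcal U(\mathfrak a)}(B(f_{(2)})_{(1)})\big)\,B(f_{(2)})_{(2)}$. *)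

(* Defs.v *)
From HB Require Import structures.
From mathcomp Require Import all_boot all_algebra.
From mathcomp Require Import boolp.

Set Implicit Arguments.
Unset Strict Implicit.
Unset Printing Implicit Defensive.

Import GRing.Theory.
Local Open Scope ring_scope.
Local Open Scope quotient_scope.

HB.mixin Record Lmodule_isLieAlgebra (K : fieldType) L of GRing.Lmodule K L := {
  lie : L -> L -> L;
  lie_linearl : forall y : L, linear (fun x => lie x y);
  lie_linearr : forall x : L, linear (lie x);
  liexx : forall x : L, lie x x = 0;
  jacobi : forall x y z : L,
    lie x (lie y z) + lie y (lie z x) + lie z (lie x y) = 0
}.

#[short(type="lieAlgType")]
HB.structure Definition LieAlgebra (K : fieldType) :=
  {L of GRing.Lmodule K L & Lmodule_isLieAlgebra K L}.

Record rlieModule (K : fieldType) (g a : lieAlgType K) := RLieModule {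
  lact :> g -> a -> g;
  lact_linearl : forall b : a, linear (fun x => lact x b);
  lact_linearr : forall x : g, linear (lact x);
  lact_der : forall (x y : g) (b : a),
    lact (lie x y) b = lie (lact x b) y + lie x (lact y b);
  lact_lie : forall (x : g) (b c : a),
    lact x (lie b c) = lact (lact x b) c - lact (lact x c) b
}.

(** The enveloping algebra U(g) is the associative unital K-algebra generated by the set g, subject to
  the linear relations of g and to x y = y x + [x, y].  It is the quotient of
  the formal algebra expressions in elements of g by the smallest congruence
  containing the axioms of K-algebras and these relations. *)

Inductive uterm (K : fieldType) (g : lieAlgType K) : Type :=
| UScal of K
| UGen of g
| UAdd of uterm g & uterm g
| UMul of uterm g & uterm g.
Arguments UScal {K g}.
Arguments UGen {K g}.

Inductive uterm_eq (K : fieldType) (g : lieAlgType K) :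
    uterm g -> uterm g -> Prop :=
| ueq_refl u : uterm_eq u u
| ueq_sym u v : uterm_eq u v -> uterm_eq v u
| ueq_trans u v w : uterm_eq u v -> uterm_eq v w -> uterm_eq u w
| ueq_add u u' v v' : uterm_eq u u' -> uterm_eq v v' ->
    uterm_eq (UAdd u v) (UAdd u' v')
| ueq_mul u u' v v' : uterm_eq u u' -> uterm_eq v v' ->
    uterm_eq (UMul u v) (UMul u' v')
| ueq_addA u v w : uterm_eq (UAdd u (UAdd v w)) (UAdd (UAdd u v) w)
| ueq_addC u v : uterm_eq (UAdd u v) (UAdd v u)
| ueq_add0 u : uterm_eq (UAdd (UScal 0) u) u
| ueq_mulA u v w : uterm_eq (UMul u (UMul v w)) (UMul (UMul u v) w)
| ueq_mulDl u v w : uterm_eq (UMul (UAdd u v) w) (UAdd (UMul u w) (UMul v w))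
| ueq_mulDr u v w : uterm_eq (UMul u (UAdd v w)) (UAdd (UMul u v) (UMul u w))
| ueq_mul1 u : uterm_eq (UMul (UScal 1) u) u
| ueq_mul0 u : uterm_eq (UMul (UScal 0) u) (UScal 0)
| ueq_scalD c d : uterm_eq (UScal (c + d)) (UAdd (UScal c) (UScal d))
| ueq_scalM c d : uterm_eq (UScal (c * d)) (UMul (UScal c) (UScal d))
| ueq_scalC c u : uterm_eq (UMul (UScal c) u) (UMul u (UScal c))
| ueq_genD x y : uterm_eq (UGen (x + y)) (UAdd (UGen x) (UGen y))
| ueq_genZ c x : uterm_eq (UGen (c *: x)) (UMul (UScal c) (UGen x))
| ueq_lie x y : uterm_eq (UMul (UGen x) (UGen y))
    (UAdd (UMul (UGen y) (UGen x)) (UGen (lie x y))).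

HB.instance Definition _ (K : fieldType) (g : lieAlgType K) :=
  gen_eqMixin (uterm g).
HB.instance Definition _ (K : fieldType) (g : lieAlgType K) :=
  gen_choiceMixin (uterm g).

Section Enveloping.
Variables (K : fieldType) (g : lieAlgType K).

Definition uterm_eqb (u v : uterm g) : bool := `[< uterm_eq u v >].

Lemma uterm_eqb_refl : reflexive uterm_eqb.
Proof. by move=> u; apply/asboolP; apply: ueq_refl. Qed.

Lemma uterm_eqb_sym : symmetric uterm_eqb.
Proof. by move=> u v; apply/asboolP/asboolP; apply: ueq_sym. Qed.

Lemma uterm_eqb_trans : transitive uterm_eqb.
Proof.
by move=> v u w /asboolP uv /asboolP vw; apply/asboolP; apply: ueq_trans vw.
Qed.

Canonical uterm_equiv :=
  EquivRel uterm_eqb uterm_eqb_refl uterm_eqb_sym uterm_eqb_trans.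

Definition uea := {eq_quot uterm_equiv}.
HB.instance Definition _ := Choice.on uea.
HB.instance Definition _ : EqQuotient _ uterm_equiv uea :=
  EqQuotient.on uea.

Definition upi (u : uterm g) : uea := \pi_uea u.

Lemma upiP u v : upi u = upi v <-> uterm_eq u v.
Proof.
split=> [/eqP|uv]; first by rewrite eqmodE => /asboolP.
by apply/eqP; rewrite eqmodE; apply/asboolP.
Qed.

Lemma upiK (X : uea) : upi (repr X) = X.
Proof. exact: reprK. Qed.

Lemma ueaP (P : uea -> Prop) : (forall u, P (upi u)) -> forall X, P X.
Proof. by move=> HP X; rewrite -(upiK X). Qed.

Definition uea_add (X Y : uea) := upi (UAdd (repr X) (repr Y)).
Definition uea_mul (X Y : uea) := upi (UMul (repr X) (repr Y)).
Definition uea_scale (c : K) (X : uea) := upi (UMul (UScal c) (repr X)).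
Definition uea_opp (X : uea) := uea_scale (-1) X.

Lemma uea_addE u v : uea_add (upi u) (upi v) = upi (UAdd u v).
Proof. by apply/upiP; apply: ueq_add; apply/upiP; rewrite upiK. Qed.
Lemma uea_mulE u v : uea_mul (upi u) (upi v) = upi (UMul u v).
Proof. by apply/upiP; apply: ueq_mul; apply/upiP; rewrite upiK. Qed.
Lemma uea_scaleE c u : uea_scale c (upi u) = upi (UMul (UScal c) u).
Proof.
apply/upiP; apply: ueq_mul; first exact: ueq_refl.
by apply/upiP; rewrite upiK.
Qed.
Let E := (uea_addE, uea_mulE, uea_scaleE).

Fact uea_addA : associative uea_add.
Proof.
elim/ueaP=> u; elim/ueaP=> v; elim/ueaP=> w.
by rewrite !E; apply/upiP; apply: ueq_addA.
Qed.
Fact uea_addC : commutative uea_add.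
Proof.
by elim/ueaP=> u; elim/ueaP=> v; rewrite !E; apply/upiP; apply: ueq_addC.
Qed.
Fact uea_add0 : left_id (upi (UScal 0)) uea_add.
Proof. by elim/ueaP=> u; rewrite !E; apply/upiP; apply: ueq_add0. Qed.
Fact uea_addN : left_inverse (upi (UScal 0)) uea_opp uea_add.
Proof.
elim/ueaP=> u; rewrite /uea_opp !E; apply/upiP.
apply: ueq_trans (ueq_add (ueq_refl _) (ueq_sym (ueq_mul1 u))) _.
apply: ueq_trans (ueq_sym (ueq_mulDl _ _ _)) _.
apply: ueq_trans (ueq_mul0 u); apply: ueq_mul (ueq_refl u).
by rewrite -(addNr 1); apply: ueq_sym; apply: ueq_scalD.
Qed.

HB.instance Definition _ := GRing.isZmodule.Build uea
  uea_addA uea_addC uea_add0 uea_addN.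

Lemma upiD u v : upi (UAdd u v) = upi u + upi v.
Proof. by rewrite -uea_addE. Qed.

Fact uea_mulA : associative uea_mul.
Proof.
elim/ueaP=> u; elim/ueaP=> v; elim/ueaP=> w.
by rewrite !E; apply/upiP; apply: ueq_mulA.
Qed.
Fact uea_mul1l : left_id (upi (UScal 1)) uea_mul.
Proof. by elim/ueaP=> u; rewrite !E; apply/upiP; apply: ueq_mul1. Qed.
Fact uea_mul1r : right_id (upi (UScal 1)) uea_mul.
Proof.
elim/ueaP=> u; rewrite !E; apply/upiP.
exact: ueq_trans (ueq_sym (ueq_scalC _ _)) (ueq_mul1 _).
Qed.
Fact uea_mulDl : left_distributive uea_mul +%R.
Proof.
elim/ueaP=> u; elim/ueaP=> v; elim/ueaP=> w.
by rewrite -[X in uea_mul X _]upiD !E -upiD; apply/upiP; apply: ueq_mulDl.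
Qed.
Fact uea_mulDr : right_distributive uea_mul +%R.
Proof.
elim/ueaP=> u; elim/ueaP=> v; elim/ueaP=> w.
by rewrite -[X in uea_mul _ X]upiD !E -upiD; apply/upiP; apply: ueq_mulDr.
Qed.

(* The evaluation sending the generators to 0 separates 1 from 0. *)
Fixpoint uterm_counit (u : uterm g) : K :=
  match u with
  | UScal c => c
  | UGen _ => 0
  | UAdd u v => uterm_counit u + uterm_counit v
  | UMul u v => uterm_counit u * uterm_counit v
  end.

Lemma uterm_counitP u v : uterm_eq u v -> uterm_counit u = uterm_counit v.
Proof.
elim=> //= *; rewrite ?(addrA, mulrA, mulrDl, mulrDr, add0r, mul0r, mulr0, mul1r)//.
all: by [congruence | rewrite addrC | rewrite mulrC].
Qed.

Fact uea_1_neq0 : upi (UScal 1) != 0.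
Proof.
apply/negP=> /eqP/upiP/uterm_counitP /= /eqP.
by rewrite oner_eq0.
Qed.

HB.instance Definition _ := GRing.Zmodule_isNzRing.Build uea
  uea_mulA uea_mul1l uea_mul1r uea_mulDl uea_mulDr uea_1_neq0.

Lemma upiM u v : upi (UMul u v) = upi u * upi v.
Proof. by rewrite -uea_mulE. Qed.

Fact uea_scaleM c (X : uea) : uea_scale c X = upi (UScal c) * X.
Proof. by elim/ueaP: X => u; rewrite uea_scaleE upiM. Qed.

Fact uea_scaleA c d X : uea_scale c (uea_scale d X) = uea_scale (c * d) X.
Proof.
rewrite !uea_scaleM mulrA -upiM; congr (_ * _).
by apply/upiP; apply: ueq_sym; apply: ueq_scalM.
Qed.
Fact uea_scale1 : left_id 1 uea_scale.
Proof. by move=> X; rewrite uea_scaleM mul1r. Qed.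
Fact uea_scaleDr : right_distributive uea_scale +%R.
Proof. by move=> c X Y; rewrite !uea_scaleM mulrDr. Qed.
Fact uea_scaleDl X : {morph uea_scale^~ X : c d / c + d}.
Proof.
move=> c d; rewrite !uea_scaleM -mulrDl -upiD; congr (_ * _).
by apply/upiP; apply: ueq_scalD.
Qed.

HB.instance Definition _ := GRing.Zmodule_isLmodule.Build K uea
  uea_scaleA uea_scale1 uea_scaleDr uea_scaleDl.

Lemma uscaleE c (X : uea) : c *: X = upi (UScal c) * X.
Proof. exact: uea_scaleM. Qed.

Lemma upi_comm c (X : uea) : upi (UScal c) * X = X * upi (UScal c).
Proof. by elim/ueaP: X => u; rewrite -!upiM; apply/upiP; apply: ueq_scalC. Qed.

Fact uea_scaleAl c (X Y : uea) : c *: (X * Y) = (c *: X) * Y.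
Proof. by rewrite !uscaleE mulrA. Qed.
HB.instance Definition _ := GRing.Lmodule_isLalgebra.Build K uea uea_scaleAl.

Fact uea_scaleAr c (X Y : uea) : c *: (X * Y) = X * (c *: Y).
Proof. by rewrite !uscaleE !mulrA upi_comm. Qed.
HB.instance Definition _ := GRing.Lalgebra_isAlgebra.Build K uea uea_scaleAr.

Lemma upiC c : upi (UScal c) = c%:A.
Proof. by rewrite uscaleE mulr1. Qed.

Definition uin (x : g) : uea := upi (UGen x).

Fact uin_is_linear : linear uin.
Proof.
move=> c x y; rewrite uscaleE /uin -upiM -upiD; apply/upiP.
apply: ueq_trans (ueq_genD _ _) _; apply: ueq_add (ueq_refl _).
exact: ueq_genZ.
Qed.
HB.instance Definition _ := GRing.isLinear.Build K g uea _ uin uin_is_linear.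

Lemma uin_lie x y : uin (lie x y) = uin x * uin y - uin y * uin x.
Proof.
apply/esym/eqP; rewrite subr_eq addrC -!upiM -upiD.
by apply/eqP/upiP; apply: ueq_lie.
Qed.

Lemma uea_ind (P : uea -> Prop) :
  P 1 -> (forall x, P (uin x)) ->
  (forall c X, P X -> P (c *: X)) ->
  (forall X Y, P X -> P Y -> P (X + Y)) ->
  (forall X Y, P X -> P Y -> P (X * Y)) -> forall X, P X.
Proof.
move=> P1 Pg PZ PD PM; elim/ueaP; elim=> [c|x|u Pu v Pv|u Pu v Pv].
- by rewrite upiC; apply: PZ.
- exact: Pg.
- by rewrite upiD; apply: PD.
- by rewrite upiM; apply: PM.
Qed.

End Enveloping.

Section Lift.
Variables (K : fieldType) (g : lieAlgType K) (A : algType K).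

Definition lie_to_alg (phi : g -> A) : Prop :=
  linear phi /\ forall x y, phi (lie x y) = phi x * phi y - phi y * phi x.

Fixpoint uterm_eval (phi : g -> A) (u : uterm g) : A :=
  match u with
  | UScal c => c%:A
  | UGen x => phi x
  | UAdd u v => uterm_eval phi u + uterm_eval phi v
  | UMul u v => uterm_eval phi u * uterm_eval phi v
  end.

Lemma uterm_evalP phi u v : lie_to_alg phi ->
  uterm_eq u v -> uterm_eval phi u = uterm_eval phi v.
Proof.
move=> [philin philie].
have phiD x y : phi (x + y) = phi x + phi y by rewrite -[x]scale1r philin !scale1r.
have phi0 : phi 0 = 0 by apply: (addrI (phi 0)); rewrite -phiD !addr0.
elim=> //=; try by move=> *; congruence.
- by move=> *; rewrite addrA.
- by move=> *; rewrite addrC.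
- by move=> *; rewrite scale0r add0r.
- by move=> *; rewrite mulrA.
- by move=> *; rewrite mulrDl.
- by move=> *; rewrite mulrDr.
- by move=> *; rewrite scale1r mul1r.
- by move=> *; rewrite scale0r mul0r.
- by move=> *; rewrite scalerDl.
- by move=> *; rewrite mulr_algl scalerA.
- by move=> *; rewrite mulr_algl mulr_algr.
- by move=> c x; rewrite -[c *: x]addr0 philin phi0 addr0 mulr_algl.
- by move=> x y; rewrite philie addrC subrK.
Qed.

Definition ulift (phi : g -> A) (X : uea g) : A := uterm_eval phi (repr X).

Section Theory.
Variable phi : g -> A.
Hypothesis phiP : lie_to_alg phi.

Lemma ulift_pi u : ulift phi (upi u) = uterm_eval phi u.
Proof. by apply: uterm_evalP => //; apply/upiP; rewrite upiK. Qed.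

Lemma ulift_gen x : ulift phi (uin x) = phi x.
Proof. by rewrite ulift_pi. Qed.

Lemma ulift1 : ulift phi 1 = 1.
Proof. by rewrite ulift_pi /= scale1r. Qed.

Lemma uliftM X Y : ulift phi (X * Y) = ulift phi X * ulift phi Y.
Proof.
by elim/ueaP: X => u; elim/ueaP: Y => v; rewrite -upiM !ulift_pi.
Qed.

Lemma ulift_linear : linear (ulift phi).
Proof.
move=> c; elim/ueaP=> u; elim/ueaP=> v.
by rewrite uscaleE -upiM -upiD !ulift_pi /= mulr_algl.
Qed.

Lemma ulift_unique (F : uea g -> A) : linear F -> F 1 = 1 ->
  {morph F : X Y / X * Y} -> (forall x, F (uin x) = phi x) -> F =1 ulift phi.
Proof.
move=> Flin F1 FM Fgen.
have FD X Y : F (X + Y) = F X + F Y by rewrite -[X]scale1r Flin !scale1r.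
have F0 : F 0 = 0 by apply: (addrI (F 0)); rewrite -FD !addr0.
have FZ c X : F (c *: X) = c *: F X by rewrite -[c *: X]addr0 Flin F0 addr0.
elim/ueaP; elim=> [c|x|u IHu v IHv|u IHu v IHv].
- by rewrite ulift_pi upiC FZ F1.
- by rewrite Fgen ulift_pi.
- by rewrite [RHS]ulift_pi /= upiD FD IHu IHv !ulift_pi.
- by rewrite [RHS]ulift_pi /= upiM FM IHu IHv !ulift_pi.
Qed.

End Theory.
End Lift.

(** V ⊗ W is the quotient of the formal sums of pairs (v, w) by the smallest
  additive congruence containing the bilinearity relations. *)

Inductive tensor_eq (K : fieldType) (V W : lmodType K) :
    seq (V * W) -> seq (V * W) -> Prop :=
| teq_refl s : tensor_eq s s
| teq_sym s t : tensor_eq s t -> tensor_eq t s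
| teq_trans s t r : tensor_eq s t -> tensor_eq t r -> tensor_eq s r
| teq_cat s s' t t' : tensor_eq s s' -> tensor_eq t t' ->
    tensor_eq (s ++ t) (s' ++ t')
| teq_catC s t : tensor_eq (s ++ t) (t ++ s)
| teq_Dl v v' w : tensor_eq [:: (v + v', w)] [:: (v, w); (v', w)]
| teq_Dr v w w' : tensor_eq [:: (v, w + w')] [:: (v, w); (v, w')]
| teq_Z c v w : tensor_eq [:: (c *: v, w)] [:: (v, c *: w)]
| teq_0 w : tensor_eq [:: (0, w)] [::].

Section Tensor.
Variables (K : fieldType) (V W : lmodType K).

Definition tensor_eqb (s t : seq (V * W)) : bool := `[< tensor_eq s t >].

Lemma tensor_eqb_refl : reflexive tensor_eqb.
Proof. by move=> u; apply/asboolP; apply: teq_refl. Qed.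

Lemma tensor_eqb_sym : symmetric tensor_eqb.
Proof. by move=> u v; apply/asboolP/asboolP; apply: teq_sym. Qed.

Lemma tensor_eqb_trans : transitive tensor_eqb.
Proof.
by move=> v u w /asboolP uv /asboolP vw; apply/asboolP; apply: teq_trans vw.
Qed.

Canonical tensor_equiv :=
  EquivRel tensor_eqb tensor_eqb_refl tensor_eqb_sym tensor_eqb_trans.

Definition tensor := {eq_quot tensor_equiv}.
HB.instance Definition _ := Choice.on tensor.
HB.instance Definition _ : EqQuotient _ tensor_equiv tensor :=
  EqQuotient.on tensor.

Definition tpi (s : seq (V * W)) : tensor := \pi_tensor s.

Lemma tpiP s t : tpi s = tpi t <-> tensor_eq s t.
Proof.
split=> [/eqP|uv]; first by rewrite eqmodE => /asboolP.
by apply/eqP; rewrite eqmodE; apply/asboolP.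
Qed.

Lemma tpiK (x : tensor) : tpi (repr x) = x.
Proof. exact: reprK. Qed.

Lemma tensorP (P : tensor -> Prop) : (forall s, P (tpi s)) -> forall x, P x.
Proof. by move=> HP x; rewrite -(tpiK x). Qed.

Definition seq_scale (c : K) (s : seq (V * W)) :=
  [seq (c *: p.1, p.2) | p <- s].

Definition tensor_add (x y : tensor) := tpi (repr x ++ repr y).
Definition tensor_scale (c : K) (x : tensor) := tpi (seq_scale c (repr x)).
Definition tensor_opp (x : tensor) := tensor_scale (-1) x.

Lemma tensor_addE s t : tensor_add (tpi s) (tpi t) = tpi (s ++ t).
Proof. by apply/tpiP; apply: teq_cat; apply/tpiP; rewrite tpiK. Qed.

Lemma teq_scale c s t :
  tensor_eq s t -> tensor_eq (seq_scale c s) (seq_scale c t).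
Proof.
elim=> {s t} /=.
- by move=> *; apply: teq_refl.
- by move=> *; apply: teq_sym.
- by move=> s t r _ st _; apply: teq_trans.
- by move=> *; rewrite /seq_scale !map_cat; apply: teq_cat.
- by move=> *; rewrite /seq_scale !map_cat; apply: teq_catC.
- by move=> *; rewrite scalerDr; apply: teq_Dl.
- by move=> *; apply: teq_Dr.
- by move=> d v w; rewrite scalerA mulrC -scalerA; apply: teq_Z.
- by move=> *; rewrite scaler0; apply: teq_0.
Qed.

Lemma tensor_scaleE c s : tensor_scale c (tpi s) = tpi (seq_scale c s).
Proof. by apply/tpiP; apply: teq_scale; apply/tpiP; rewrite tpiK. Qed.

Fact tensor_addA : associative tensor_add.
Proof.
elim/tensorP=> u; elim/tensorP=> v; elim/tensorP=> w.
by rewrite !tensor_addE catA.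
Qed.
Fact tensor_addC : commutative tensor_add.
Proof.
elim/tensorP=> u; elim/tensorP=> v.
by rewrite !tensor_addE; apply/tpiP; apply: teq_catC.
Qed.
Fact tensor_add0 : left_id (tpi [::]) tensor_add.
Proof. by elim/tensorP=> u; rewrite !tensor_addE. Qed.

Lemma tpi_cons p s : tpi (p :: s) = tensor_add (tpi [:: p]) (tpi s).
Proof. by rewrite tensor_addE. Qed.

Fact tensor_scaleDl x c d :
  tensor_scale (c + d) x = tensor_add (tensor_scale c x) (tensor_scale d x).
Proof.
elim/tensorP: x; elim=> [|p s IHs].
  by rewrite !tensor_scaleE /= tensor_add0.
rewrite !tensor_scaleE /= (tpi_cons _ (seq_scale (c + d) s)).
rewrite (tpi_cons _ (seq_scale c s)) (tpi_cons _ (seq_scale d s)).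
rewrite -!(tensor_scaleE _ s) IHs.
have -> : tpi [:: ((c + d) *: p.1, p.2)] =
          tensor_add (tpi [:: (c *: p.1, p.2)]) (tpi [:: (d *: p.1, p.2)]).
  by rewrite tensor_addE scalerDl; apply/tpiP; apply: teq_Dl.
by rewrite !tensor_addA; congr tensor_add; rewrite -!tensor_addA;
  congr tensor_add; apply: tensor_addC.
Qed.

Fact tensor_scale1 x : tensor_scale 1 x = x.
Proof.
elim/tensorP: x => s; rewrite tensor_scaleE; congr tpi.
by rewrite /seq_scale -[RHS]map_id; apply: eq_map => -[v w] /=; rewrite scale1r.
Qed.

Fact tensor_scale0 x : tensor_scale 0 x = tpi [::].
Proof.
elim/tensorP: x => s; rewrite tensor_scaleE; elim: s => //= p s IHs.
rewrite tpi_cons IHs tensor_addC tensor_add0 scale0r.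
by apply/tpiP; apply: teq_0.
Qed.

Fact tensor_addN : left_inverse (tpi [::]) tensor_opp tensor_add.
Proof.
move=> x; rewrite /tensor_opp -[X in tensor_add _ X]tensor_scale1.
by rewrite -tensor_scaleDl addNr tensor_scale0.
Qed.

HB.instance Definition _ := GRing.isZmodule.Build tensor
  tensor_addA tensor_addC tensor_add0 tensor_addN.

Lemma tpi_cat s t : tpi (s ++ t) = tpi s + tpi t.
Proof. by rewrite -tensor_addE. Qed.

Fact tensor_scaleA c d x :
  tensor_scale c (tensor_scale d x) = tensor_scale (c * d) x.
Proof.
elim/tensorP: x => s; rewrite !tensor_scaleE; congr tpi.
by rewrite /seq_scale -map_comp; apply: eq_map => p /=; rewrite scalerA.
Qed.
Fact tensor_scaleDr : right_distributive tensor_scale +%R.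
Proof.
move=> c; elim/tensorP=> s; elim/tensorP=> t.
by rewrite -tpi_cat !tensor_scaleE /seq_scale map_cat tpi_cat.
Qed.

HB.instance Definition _ := GRing.Zmodule_isLmodule.Build K tensor
  tensor_scaleA tensor_scale1 tensor_scaleDr (fun x c d => tensor_scaleDl x c d).

Definition tens (v : V) (w : W) : tensor := tpi [:: (v, w)].

Lemma tensDl v v' w : tens (v + v') w = tens v w + tens v' w.
Proof. by rewrite -tpi_cat; apply/tpiP; apply: teq_Dl. Qed.

Lemma tensDr v w w' : tens v (w + w') = tens v w + tens v w'.
Proof. by rewrite -tpi_cat; apply/tpiP; apply: teq_Dr. Qed.

Lemma tensZl c v w : tens (c *: v) w = c *: tens v w.
Proof. by rewrite /tens [RHS]tensor_scaleE. Qed.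

Lemma tensZr c v w : tens v (c *: w) = c *: tens v w.
Proof. by rewrite -tensZl; apply/esym/tpiP; apply: teq_Z. Qed.

Lemma tens_linearl w : linear (tens^~ w).
Proof. by move=> c v v'; rewrite tensDl tensZl. Qed.

Lemma tens_linearr v : linear (tens v).
Proof. by move=> c w w'; rewrite tensDr tensZr. Qed.

Lemma tpi_sum s : tpi s = \sum_(p <- s) tens p.1 p.2.
Proof.
elim: s => [|[v w] s IHs]; first by rewrite big_nil.
by rewrite big_cons -IHs -tpi_cat.
Qed.

End Tensor.

Notation "V ⊗ W" := (tensor V W) (at level 40, left associativity) : type_scope.
Notation "v ⊗ w" := (tens v w) (at level 40, left associativity) : ring_scope.

(** [sweedler F x] is F(x_(1), x_(2)) in Sweedler notation: for bilinear F, the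
  image of x under the linear map induced by F. *)

Section Sweedler.
Variables (K : fieldType) (V W Z : lmodType K).

Definition sweedler (F : V -> W -> Z) (x : V ⊗ W) : Z :=
  \sum_(p <- repr x) F p.1 p.2.

Definition bilinear2 (F : V -> W -> Z) : Prop :=
  (forall w, linear (F^~ w)) /\ (forall v, linear (F v)).

Section Theory.
Variable F : V -> W -> Z.
Hypothesis FP : bilinear2 F.

Lemma sweedler_tpi s : sweedler F (tpi s) = \sum_(p <- s) F p.1 p.2.
Proof.
have [Fl Fr] := FP.
have FDl v v' w : F (v + v') w = F v w + F v' w.
  by have := Fl w 1 v v'; rewrite !scale1r.
have FDr v w w' : F v (w + w') = F v w + F v w'.
  by have := Fr v 1 w w'; rewrite !scale1r.
have F0l w : F 0 w = 0 by apply: (addrI (F 0 w)); rewrite -FDl !addr0.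
have F0r v : F v 0 = 0 by apply: (addrI (F v 0)); rewrite -FDr !addr0.
have FZl c v w : F (c *: v) w = c *: F v w.
  by have := Fl w c v 0; rewrite F0l !addr0.
have FZr c v w : F v (c *: w) = c *: F v w.
  by have := Fr v c w 0; rewrite F0r !addr0.
have : tensor_eq (repr (tpi s)) s by apply/tpiP; rewrite tpiK.
rewrite /sweedler; move: (repr _) => r; elim=> {r s}; try by move=> *; congruence.
- by move=> *; rewrite !big_cat; congr (_ + _).
- by move=> *; rewrite !big_cat /= addrC.
- by move=> *; rewrite !big_cons !big_nil !addr0 FDl.
- by move=> *; rewrite !big_cons !big_nil !addr0 FDr.
- by move=> *; rewrite !big_cons !big_nil FZl FZr.
- by move=> *; rewrite !big_cons !big_nil F0l addr0.
Qed.

Lemma sweedler_tens v w : sweedler F (v ⊗ w) = F v w.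
Proof. by rewrite sweedler_tpi big_seq1. Qed.

Lemma sweedler_linear : linear (sweedler F).
Proof.
have [Fl _] := FP.
have FZl c v w : F (c *: v) w = c *: F v w.
  have F0l : F 0 w = 0.
    by have := Fl w (-1) 0 0; rewrite scaler0 addr0 scaleN1r addNr.
  by have := Fl w c v 0; rewrite F0l !addr0.
move=> c; elim/tensorP=> s; elim/tensorP=> t.
rewrite [c *: _]tensor_scaleE -tpi_cat !sweedler_tpi big_cat big_map /=.
by rewrite scaler_sumr; congr (_ + _); apply: eq_bigr => p _; rewrite FZl.
Qed.

End Theory.
End Sweedler.

Section TensorAlgebra.
Variables (K : fieldType) (A B : algType K).

Definition tensor_mul (x y : A ⊗ B) : A ⊗ B :=
  sweedler (fun a b => sweedler (fun c d => (a * c) ⊗ (b * d)) y) x.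

Let mul2_bilin (a : A) (b : B) :
  bilinear2 (fun c d => (a * c) ⊗ (b * d)).
Proof.
split=> [d c v v'|c d w w'].
  by rewrite mulrDr -scalerAr tens_linearl.
by rewrite mulrDr -scalerAr tens_linearr.
Qed.

Lemma sweedler_suml (V W Z : lmodType K) (F G : V -> W -> Z) c x :
  sweedler (fun v w => c *: F v w + G v w) x = c *: sweedler F x + sweedler G x.
Proof. by rewrite /sweedler big_split /= scaler_sumr. Qed.

Lemma eq_sweedler (V W Z : lmodType K) (F G : V -> W -> Z) x :
  (forall v w, F v w = G v w) -> sweedler F x = sweedler G x.
Proof. by move=> FG; apply: eq_bigr => p _; apply: FG. Qed.

Let mul_bilin y :
  bilinear2 (fun a b => sweedler (fun c d => (a * c) ⊗ (b * d)) y : A ⊗ B).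
Proof.
split=> [b c a a'|a c b b']; rewrite -sweedler_suml; apply: eq_sweedler => u v.
  by rewrite mulrDl -scalerAl tens_linearl.
by rewrite mulrDl -scalerAl tens_linearr.
Qed.

Lemma tensor_mul_tens a b c d :
  tensor_mul (a ⊗ b) (c ⊗ d) = (a * c) ⊗ (b * d).
Proof. by rewrite /tensor_mul (sweedler_tens (mul_bilin _)) sweedler_tens. Qed.

Fact tensor_mul_linearl y : linear (tensor_mul^~ y).
Proof. exact: sweedler_linear. Qed.

Fact tensor_mul_linearr x : linear (tensor_mul x).
Proof.
move=> c y y'; rewrite /tensor_mul -sweedler_suml; apply: eq_sweedler => a b.
by rewrite sweedler_linear.
Qed.

Fact tensor_mulDl : left_distributive tensor_mul +%R.
Proof. by move=> x y z; have := tensor_mul_linearl z 1 x y; rewrite !scale1r. Qed.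
Fact tensor_mulDr : right_distributive tensor_mul +%R.
Proof. by move=> x y z; have := tensor_mul_linearr x 1 y z; rewrite !scale1r. Qed.

Lemma tensor_ind (V W : lmodType K) (P : V ⊗ W -> Prop) :
  P 0 -> (forall v w, P (v ⊗ w)) -> (forall x y, P x -> P y -> P (x + y)) ->
  forall x, P x.
Proof.
move=> P0 Pt PD x; rewrite -(tpiK x) tpi_sum.
by elim/big_ind: _ => // p _; apply: Pt.
Qed.

Let mul0x x : tensor_mul 0 x = 0.
Proof. by apply: (addrI (tensor_mul 0 x)); rewrite -tensor_mulDl !addr0. Qed.
Let mulx0 x : tensor_mul x 0 = 0.
Proof. by apply: (addrI (tensor_mul x 0)); rewrite -tensor_mulDr !addr0. Qed.

Fact tensor_mulA : associative tensor_mul.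
Proof.
elim/tensor_ind=> [|a b|x x' IH IH'] y z; first by rewrite !mul0x.
  elim/tensor_ind: y z => [|c d|y y' IH IH'] z; first by rewrite !(mul0x,mulx0).
    elim/tensor_ind: z => [|e f|z z' IH IH']; first by rewrite !mulx0.
      by rewrite !tensor_mul_tens !mulrA.
    by rewrite !tensor_mulDr IH IH'.
  by rewrite tensor_mulDl !tensor_mulDr tensor_mulDl IH IH'.
by rewrite !tensor_mulDl IH IH'.
Qed.
Fact tensor_mul1l : left_id (1 ⊗ 1) tensor_mul.
Proof.
elim/tensor_ind=> [|a b|x y IH IH']; first by rewrite mulx0.
  by rewrite tensor_mul_tens !mul1r.
by rewrite tensor_mulDr IH IH'.
Qed.
Fact tensor_mul1r : right_id (1 ⊗ 1) tensor_mul.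
Proof.
elim/tensor_ind=> [|a b|x y IH IH']; first by rewrite mul0x.
  by rewrite tensor_mul_tens !mulr1.
by rewrite tensor_mulDl IH IH'.
Qed.

HB.instance Definition _ := GRing.Zmodule_isPzRing.Build (A ⊗ B)%type
  tensor_mulA tensor_mul1l tensor_mul1r tensor_mulDl tensor_mulDr.

Lemma tensM (a c : A) (b d : B) : (a ⊗ b) * (c ⊗ d) = (a * c) ⊗ (b * d).
Proof. exact: tensor_mul_tens. Qed.

End TensorAlgebra.

Section ConverseAlgebra.
Variables (K : fieldType) (A : algType K).

HB.instance Definition _ := GRing.Zmodule_isLmodule.Build K A^c
  (@scalerA K A) (@scale1r K A) (@scalerDr K A) (@scalerDl K A).

Fact converse_scalerAl (c : K) (x y : A^c) : c *: (x * y) = (c *: x) * y.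
Proof. exact: (@scalerAr K A c y x). Qed.
HB.instance Definition _ := GRing.Lmodule_isLalgebra.Build K A^c converse_scalerAl.

Fact converse_scalerAr (c : K) (x y : A^c) : c *: (x * y) = x * (c *: y).
Proof. exact: (@scalerAl K A c y x). Qed.
HB.instance Definition _ := GRing.Lalgebra_isAlgebra.Build K A^c converse_scalerAr.

End ConverseAlgebra.

Section Counit.
Variables (K : fieldType) (g : lieAlgType K).

Definition counit : uea g -> K := @ulift K g K^o (fun _ => 0).

Fact counit_subproof : @lie_to_alg K g K^o (fun _ => 0).
Proof. by split=> [c x y|x y]; rewrite ?scaler0 ?addr0 // !mul0r subr0. Qed.

Lemma counit_linear : @GRing.linear_for K (uea g) K *%R counit.
Proof. exact: (ulift_linear counit_subproof). Qed.
Lemma counit_gen x : counit (uin x) = 0.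
Proof. exact: (ulift_gen counit_subproof). Qed.
Lemma counit1 : counit 1 = 1.
Proof. exact: (ulift1 counit_subproof). Qed.
Lemma counitM : {morph counit : X Y / X * Y}.
Proof. exact: (uliftM counit_subproof). Qed.

End Counit.

Section TensorUea.
Variables (K : fieldType) (g h : lieAlgType K).

Fact tensor_uea_1_neq0 : (1 : uea g ⊗ uea h) != 0.
Proof.
pose F (X : uea g) (Y : uea h) : K^o := counit X * counit Y.
have FP : bilinear2 F.
  split=> [Y c X X'|X c Y Y']; rewrite /F counit_linear.
    by rewrite mulrDl -mulrA.
  by rewrite mulrDr mulrCA.
have := sweedler_tens FP 1 1; rewrite /F !counit1 mulr1 => F1.
apply/eqP => E; have : sweedler F 1 = 0.
  rewrite E; have := sweedler_linear FP (-1) 0 0.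
  by rewrite scaler0 addr0 scaleN1r addNr.
by rewrite F1 => /eqP; rewrite oner_eq0.
Qed.

HB.instance Definition _ :=
  GRing.PzSemiRing_isNonZero.Build (uea g ⊗ uea h)%type tensor_uea_1_neq0.

Fact tensor_uea_scalerAl c (x y : uea g ⊗ uea h) : c *: (x * y) = (c *: x) * y.
Proof.
have E : (c *: x + 0) * y = c *: (x * y) + 0 * y := tensor_mul_linearl y c x 0.
by rewrite mul0r !addr0 in E.
Qed.
HB.instance Definition _ :=
  GRing.Lmodule_isLalgebra.Build K (uea g ⊗ uea h)%type tensor_uea_scalerAl.

Fact tensor_uea_scalerAr c (x y : uea g ⊗ uea h) : c *: (x * y) = x * (c *: y).
Proof.
have E : x * (c *: y + 0) = c *: (x * y) + x * 0 := tensor_mul_linearr x c y 0.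
by rewrite mulr0 !addr0 in E.
Qed.
HB.instance Definition _ :=
  GRing.Lalgebra_isAlgebra.Build K (uea g ⊗ uea h)%type tensor_uea_scalerAr.

End TensorUea.

Section Hopf.
Variables (K : fieldType) (g : lieAlgType K).

Definition comul_gen (x : g) : uea g ⊗ uea g := uin x ⊗ 1 + 1 ⊗ uin x.

Fact comul_subproof : lie_to_alg comul_gen.
Proof.
split=> [c x y|x y]; rewrite /comul_gen.
  by rewrite linearP tens_linearl tens_linearr scalerDr addrACA.
rewrite !(mulrDl, mulrDr) !tensM !(mul1r, mulr1) uin_lie.
rewrite !(tensDl, tensDr) -!scaleN1r tensZl tensZr !scaleN1r.
rewrite !opprD !addrA.
set p := (_ * _) ⊗ 1; set q := 1 ⊗ (_ * _); set r := _ ⊗ _; set s := _ ⊗ _.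
by rewrite [RHS](ACl (1*5*4*8*(2*7)*(3*6)))/= !subrr !addr0 addrAC -!addrA.
Qed.

Definition comul : uea g -> uea g ⊗ uea g := ulift comul_gen.

Lemma comul_linear : linear comul.
Proof. exact: (ulift_linear comul_subproof). Qed.
Lemma comul_uin x : comul (uin x) = uin x ⊗ 1 + 1 ⊗ uin x.
Proof. exact: (ulift_gen comul_subproof). Qed.
Lemma comul1 : comul 1 = 1.
Proof. exact: (ulift1 comul_subproof). Qed.
Lemma comulM : {morph comul : X Y / X * Y}.
Proof. exact: (uliftM comul_subproof). Qed.

(* The antipode is the algebra morphism to the opposite algebra extending
   x |-> - x. *)
Definition antipode_gen (x : g) : (uea g)^c := - uin x.

Fact antipode_subproof : lie_to_alg antipode_gen.
Proof.
split=> [c x y|x y]; rewrite /antipode_gen.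
  by rewrite linearP opprD -scalerN.
by rewrite uin_lie opprB /GRing.mul /= !mulrNN.
Qed.

Definition antipode : uea g -> uea g := @ulift K g (uea g)^c antipode_gen.

Lemma antipode_linear : linear antipode.
Proof. exact: (ulift_linear antipode_subproof). Qed.
Lemma antipode_uin x : antipode (uin x) = - uin x.
Proof. exact: (ulift_gen antipode_subproof). Qed.
Lemma antipode1 : antipode 1 = 1.
Proof. exact: (ulift1 antipode_subproof). Qed.
Lemma antipodeM X Y : antipode (X * Y) = antipode Y * antipode X.
Proof. exact: (uliftM antipode_subproof). Qed.

End Hopf.

Section Action.
Variables (K : fieldType) (g a : lieAlgType K) (M : rlieModule g a).

HB.instance Definition _ (x : g) := GRing.isLinear.Build K a g _
  (lact M x) (lact_linearr M x).

Definition lact_by (b : a) (x : g) : g := M x b.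
HB.instance Definition _ (b : a) := GRing.isLinear.Build K g g _
  (lact_by b) (lact_linearl M b).

(* The derivation of U(g) extending x |-> x <| b. *)
Fixpoint uterm_der (b : a) (u : uterm g) : uea g :=
  match u with
  | UScal _ => 0
  | UGen x => uin (M x b)
  | UAdd u v => uterm_der b u + uterm_der b v
  | UMul u v => uterm_der b u * upi v + upi u * uterm_der b v
  end.

Definition uder (b : a) (X : uea g) : uea g := uterm_der b (repr X).

Lemma uterm_derP b u v : uterm_eq u v -> uterm_der b u = uterm_der b v.
Proof.
elim=> /=; try by move=> *; congruence.
- by move=> {}u u' {}v v' /upiP Eu -> /upiP Ev ->; rewrite Eu Ev.
- by move=> *; rewrite addrA.
- by move=> *; rewrite addrC.
- by move=> *; rewrite add0r.
- by move=> *; rewrite !upiM !(mulrDl, mulrDr) !mulrA addrA.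
- by move=> *; rewrite !upiD !(mulrDl, mulrDr) addrACA.
- by move=> *; rewrite !upiD !(mulrDl, mulrDr) addrACA.
- by move=> *; rewrite mul0r add0r mul1r.
- by move=> *; rewrite mul0r add0r upiC scale0r mul0r.
- by move=> *; rewrite addr0.
- by move=> *; rewrite mul0r mulr0 addr0.
- by move=> *; rewrite mul0r mulr0 addr0 add0r upi_comm.
- by move=> x y; rewrite -linearD -(linearD (lact_by b)).
- by move=> c x; rewrite mul0r add0r -uscaleE -linearZ_LR -(linearZ_LR (lact_by b)).
- move=> x y; rewrite lact_der linearD /= !uin_lie.
  rewrite -!/(uin _) !addrA.
  set p := _ * _; set q := _ * _; set r := _ * _; set s := _ * _.
  by rewrite [RHS](ACl (3*5*(1*6)*(2*4)))/= !subrr !addr0.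
Qed.

Lemma uder_pi b u : uder b (upi u) = uterm_der b u.
Proof. by apply: uterm_derP; apply/upiP; rewrite upiK. Qed.

Lemma uder_uin b x : uder b (uin x) = uin (M x b).
Proof. by rewrite uder_pi. Qed.

Lemma uderD b X Y : uder b (X + Y) = uder b X + uder b Y.
Proof. by elim/ueaP: X => u; elim/ueaP: Y => v; rewrite -upiD !uder_pi. Qed.

Lemma uderM b X Y : uder b (X * Y) = uder b X * Y + X * uder b Y.
Proof. by elim/ueaP: X => u; elim/ueaP: Y => v; rewrite -upiM !uder_pi. Qed.

Lemma uder1 b : uder b 1 = 0.
Proof. by rewrite uder_pi. Qed.

Lemma uderZ b c X : uder b (c *: X) = c *: uder b X.
Proof. by rewrite !uscaleE uderM uder_pi mul0r add0r. Qed.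

Lemma uder_linearl X : linear (uder^~ X).
Proof.
move=> c b b'; elim/uea_ind: X => [|x|d X IH|X Y IX IY|X Y IX IY].
- by rewrite !uder1 scaler0 addr0.
- by rewrite !uder_uin -linearP (linearP (M x)).
- by rewrite !uderZ IH scalerDr !scalerA mulrC.
- by rewrite !uderD IX IY scalerDr addrACA.
- rewrite !uderM IX IY mulrDl mulrDr scalerDr addrACA.
  by rewrite -scalerAl -scalerAr.
Qed.

Lemma uder_lie b c X : uder (lie b c) X = uder c (uder b X) - uder b (uder c X).
Proof.
elim/uea_ind: X => [|x|d X IH|X Y IX IY|X Y IX IY].
- rewrite !uder1; have := uderZ b 0 0; have := uderZ c 0 0.
  by rewrite !scale0r => -> ->; rewrite subrr.
- by rewrite !uder_uin lact_lie linearB.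
- by rewrite !uderZ IH scalerBr.
- by rewrite !uderD IX IY opprD addrACA.
- rewrite !(uderM, uderD) IX IY mulrBl mulrBr !opprD !addrA.
  by rewrite [RHS](ACl (1*5*4*8*(2*7)*(3*6)))/= !subrr !addr0.
Qed.

Fixpoint uterm_act (A : uterm a) (X : uea g) : uea g :=
  match A with
  | UScal c => c *: X
  | UGen b => uder b X
  | UAdd A B => uterm_act A X + uterm_act B X
  | UMul A B => uterm_act B (uterm_act A X)
  end.

Lemma uterm_act_linear A : linear (uterm_act A).
Proof.
move=> c; elim: A => [d|b|A IA B IB|A IA B IB] X Y /=.
- by rewrite scalerDr !scalerA mulrC.
- by rewrite uderD uderZ.
- by rewrite IA IB scalerDr addrACA.
- by rewrite IA IB.
Qed.

Lemma uterm_actP A B : uterm_eq A B -> uterm_act A =1 uterm_act B.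
Proof.
have actD u X Y : uterm_act u (X + Y) = uterm_act u X + uterm_act u Y.
  by have := uterm_act_linear u 1 X Y; rewrite !scale1r.
have act0 u : uterm_act u 0 = 0.
  by apply: (addrI (uterm_act u 0)); rewrite -actD !addr0.
have actZ u c X : uterm_act u (c *: X) = c *: uterm_act u X.
  by have := uterm_act_linear u c X 0; rewrite act0 !addr0.
elim=> /=.
- by [].
- by move=> u v _ E X; rewrite E.
- by move=> u v w _ E _ E' X; rewrite E E'.
- by move=> u u' v v' _ E _ E' X; rewrite E E'.
- by move=> u u' v v' _ E _ E' X; rewrite E E'.
- by move=> u v w X; rewrite addrA.
- by move=> u v X; rewrite addrC.
- by move=> u X; rewrite scale0r add0r.
- by [].
- by move=> u v w X; rewrite actD.
- by [].
- by move=> u X; rewrite scale1r.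
- by move=> u X; rewrite !scale0r act0.
- by move=> c d X; rewrite scalerDl.
- by move=> c d X; rewrite scalerA mulrC.
- by move=> c u X; rewrite actZ.
- by move=> b c X; have := uder_linearl X 1 b c; rewrite !scale1r.
- move=> c b X; have := uder_linearl X c b 0; rewrite addr0 => ->.
  have := uder_linearl X (-1) 0 0; rewrite scaler0 addr0 scaleN1r addNr => ->.
  by rewrite addr0 uderZ.
- by move=> b c X; rewrite uder_lie addrC subrK.
Qed.

(* The elements of U(a) act on the right: a product A * B acts by A first. *)
Definition uact (X : uea g) (A : uea a) : uea g := uterm_act (repr A) X.

Lemma uact_pi X A : uact X (upi A) = uterm_act A X.
Proof. by apply: uterm_actP; apply/upiP; rewrite upiK. Qed.

Lemma uact_linearl A : linear (uact^~ A).
Proof. exact: uterm_act_linear. Qed.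

Lemma uact_linearr X : linear (uact X).
Proof.
move=> c; elim/ueaP=> A; elim/ueaP=> B.
rewrite uscaleE -upiM -upiD !uact_pi /=; congr (_ + _).
rewrite -[X in uterm_act A X]addr0 uterm_act_linear.
have := uterm_act_linear A (-1) 0 0.
by rewrite scaler0 addr0 scaleN1r addNr => ->; rewrite addr0.
Qed.

Lemma uact1 X : uact X 1 = X.
Proof. by rewrite uact_pi /= scale1r. Qed.

Lemma uactA X A B : uact X (A * B) = uact (uact X A) B.
Proof. by elim/ueaP: A => A; elim/ueaP: B => B; rewrite -upiM !uact_pi. Qed.

Lemma uact_uin x b : uact (uin x) (uin b) = uin (M x b).
Proof. by rewrite uact_pi /= uder_uin. Qed.

Lemma uact_der X Y b :
  uact (X * Y) (uin b) = uact X (uin b) * Y + X * uact Y (uin b).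
Proof. by rewrite !uact_pi /= uderM. Qed.

End Action.

Section OOperators.
Variables (K : fieldType) (g a : lieAlgType K) (M : rlieModule g a).

Definition lie_O_operator (t : {linear g -> a}) : Prop :=
  forall x y, lie (t x) (t y) = t (M x (t y)) - t (M y (t x)) + t (lie x y).

Record matching_lie_O_operator (s t : {linear g -> a}) : Prop := {
  matching_fst : lie_O_operator s;
  matching_snd : lie_O_operator t;
  matching_lie : forall x y, lie (s x) (t y) = s (M x (t y)) - t (M y (s x))
}.

Record hopf_O_operator (T : {linear uea g -> uea a}) : Prop := {
  hopf_O_comul : forall f,
    comul (T f) = sweedler (fun f1 f2 => T f1 ⊗ T f2) (comul f);
  hopf_O_counit : forall f, counit (T f) = counit f;
  hopf_O_mul : forall e f,
    T e * T f = sweedler (fun f1 f2 => T (uact M e (T f1) * f2)) (comul f)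
}.

Definition hopf_O_extension (t : {linear g -> a}) (T : {linear uea g -> uea a}) :
  Prop := hopf_O_operator T /\ forall x, T (uin x) = uin (t x).

(* (A # B)(f) = A(f_(1) <| S(B(f_(2))_(1))) B(f_(2))_(2) *)
Definition hash (A B : {linear uea g -> uea a}) (f : uea g) : uea a :=
  sweedler (fun f1 f2 =>
    sweedler (fun b1 b2 => A (uact M f1 (antipode b1)) * b2) (comul (B f2)))
    (comul f).

End OOperators.

(* Main.v *)
(** Write [P_e(X) = S(e <| antipode(X_(1))) X_(2)], so that
  [(S # T)(f) = P_(f_(1))(T(f_(2)))].  The matching condition gives, for [e] and
  [f] independent of each other and [h] in [g],
    [P_(e h)(T(f)) = P_e(T(f)) s(h) - P_(e <| s(h))(T(f)) - P_e(T(f <| s(h)))],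
  by induction on the word length of [f].  Hence [S # T] satisfies the recursion
  [W(E h) = W(E) (s + t)(h) - W(E <| (s + t)(h))], [W(1) = 1] that determines the
  extension of [s + t]; the matching condition is symmetric in [s] and [t]. *)

Require Import Defs.
From HB Require Import structures.
From mathcomp Require Import all_boot all_algebra.

Set Implicit Arguments.
Unset Strict Implicit.
Unset Printing Implicit Defensive.

Import GRing.Theory.
Local Open Scope ring_scope.

(** * Linear maps and Sweedler sums *)

Section LinearCalculus.
Variables (K : fieldType) (V W : lmodType K) (f : V -> W).
Hypothesis fP : linear f.

Lemma linear_addE : {morph f : x y / x + y}.
Proof. by move=> x y; have := fP 1 x y; rewrite !scale1r. Qed.

Lemma linear_0E : f 0 = 0.
Proof. by apply: (addrI (f 0)); rewrite -linear_addE !addr0. Qed.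

Lemma linear_scaleE c : {morph f : x / c *: x}.
Proof. by move=> x; have := fP c x 0; rewrite linear_0E !addr0. Qed.

Lemma linear_oppE : {morph f : x / - x}.
Proof. by move=> x; rewrite -!scaleN1r linear_scaleE. Qed.

Lemma linear_subE : {morph f : x y / x - y}.
Proof. by move=> x y; rewrite linear_addE linear_oppE. Qed.

End LinearCalculus.

Section SweedlerCalculus.
Variables (K : fieldType) (V W Z : lmodType K).
Implicit Types (F G : V -> W -> Z) (x : tensor V W).

Lemma sweedlerD F G x :
  sweedler (fun v w => F v w + G v w) x = sweedler F x + sweedler G x.
Proof. exact: big_split. Qed.

Lemma sweedlerN F x : sweedler (fun v w => - F v w) x = - sweedler F x.
Proof. exact: sumrN. Qed.

Lemma sweedler_comp (Z' : lmodType K) (f : Z -> Z') F x : linear f ->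
  sweedler (fun v w => f (F v w)) x = f (sweedler F x).
Proof.
move=> fP; rewrite /sweedler.
by rewrite (big_morph f (linear_addE fP) (linear_0E fP)).
Qed.

End SweedlerCalculus.

(** * Induction on words in an enveloping algebra *)

Section EnvelopingInduction.
Variables (K : fieldType) (g : lieAlgType K).

(** The elements whose right multiplication preserves [P] form a subalgebra containing the
    generators, hence everything; apply this to [1 * X]. *)
Lemma uea_rind (P : uea g -> Prop) :
  P 1 -> (forall c X Y, P X -> P Y -> P (c *: X + Y)) ->
  (forall X x, P X -> P (X * uin x)) -> forall X, P X.
Proof.
move=> P1 PL PM X.
have P0 : P 0 by rewrite -(subrr 1) addrC -scaleN1r; apply: PL.
suff PX Y : P Y -> P (Y * X) by rewrite -[X]mul1r; apply: PX.
elim/uea_ind: X Y => [|x|c X IX|X Y IX IY|X Y IX IY] Z PZ.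
- by rewrite mulr1.
- exact: PM.
- by rewrite -scalerAr -[_ *: _]addr0; apply: PL (IX _ PZ) P0.
- by rewrite mulrDr -[Z * X]scale1r; apply: PL (IX _ PZ) (IY _ PZ).
- by rewrite mulrA; apply/IY/IX.
Qed.

Variables (a : lieAlgType K) (M : rlieModule g a).

(* The action of [a] does not raise the length of words, so an induction on
   length may use the hypothesis at [uact M X (uin b)] together with [X]. *)
Lemma uea_act_ind (P : uea g -> Prop) :
  P 1 -> (forall c X Y, P X -> P Y -> P (c *: X + Y)) ->
  (forall X x, P X -> (forall b, P (uact M X (uin b))) -> P (X * uin x)) ->
  forall X, P X.
Proof.
move=> P1 PL PM X.
pose act_by Y (bs : seq a) := foldl (fun Z b => uact M Z (uin b)) Y bs.
have actL bs c Y Z : act_by (c *: Y + Z) bs = c *: act_by Y bs + act_by Z bs.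
  by elim: bs Y Z => //= b bs IH Y Z; rewrite -IH uact_linearl.
have P0 : P 0 by rewrite -(subrr 1) addrC -scaleN1r; apply: PL.
(* Strengthened to all iterated images of [X], so that the hypothesis survives further actions. *)
suff: forall bs, P (act_by X bs) by move/(_ [::]).
elim/uea_rind: X => [|c X Y IX IY|X x IX] bs.
- case: bs => //= b bs; suff -> : uact M 1 (uin b) = 0.
    by elim: bs => //= b' bs IH; rewrite (linear_0E (uact_linearl M _)).
  by rewrite uact_pi /= uder1.
- by rewrite actL; apply: PL.
elim: bs X x IX => [|b bs IH] X x IX /=.
  by apply: PM => [|b]; [apply: (IX [::]) | apply: (IX [:: b])].
(* The Leibniz rule yields two words that again end in a generator, and their left factors still
   satisfy the strengthened hypothesis. *)
rewrite uact_der uact_uin -[_ * uin x]scale1r actL; apply: PL; apply: IH => //.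
by move=> bs'; apply: (IX (b :: bs')).
Qed.

End EnvelopingInduction.

(** * Closure properties of bilinear maps *)

Section Bilinear.
Variables (K : fieldType).

Lemma bilinear2_comp (V V' W W' Z : lmodType K) (F : V' -> W' -> Z)
    (p : V -> V') (q : W -> W') :
  bilinear2 F -> linear p -> linear q -> bilinear2 (fun v w => F (p v) (q w)).
Proof.
move=> [Fl Fr] pP qP; split=> [w c v v'|v c w w']; first by rewrite pP Fl.
by rewrite qP Fr.
Qed.

Lemma bilinear2D (V W Z : lmodType K) (F G : V -> W -> Z) :
  bilinear2 F -> bilinear2 G -> bilinear2 (fun v w => F v w + G v w).
Proof.
move=> [Fl Fr] [Gl Gr]; split=> [w c v v'|v c w w'].
  by rewrite Fl Gl scalerDr addrACA.
by rewrite Fr Gr scalerDr addrACA.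
Qed.

Lemma linear_mulr (A : algType K) (x : A) : linear (fun y => y * x).
Proof. by move=> c y z; rewrite mulrDl scalerAl. Qed.

Lemma linear_id (V : lmodType K) : linear (@id V).
Proof. by []. Qed.

Lemma bilinear2_mul (V W : lmodType K) (A : algType K) (p : V -> A) (q : W -> A) :
  linear p -> linear q -> bilinear2 (fun v w => p v * q w).
Proof.
move=> pP qP; split=> [w c v v'|v c w w']; first by rewrite pP mulrDl scalerAl.
by rewrite qP mulrDr scalerAr.
Qed.

(** Covers both ways in which a primitive element meets a coproduct: [p] is right multiplication by
    it or its action as a derivation. *)
Lemma bilinear2_coder (V Z : lmodType K) (F : V -> V -> Z) (p : V -> V) :
  bilinear2 F -> linear p -> bilinear2 (fun v w => F (p v) w + F v (p w)).
Proof.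
move=> FP pP; apply: bilinear2D; first exact: bilinear2_comp FP pP (@linear_id V).
exact: bilinear2_comp FP (@linear_id V) pP.
Qed.

End Bilinear.

(** * Primitive elements, the coproduct and the antipode *)

Section Coproduct.
Variables (K : fieldType) (g : lieAlgType K) (Z : lmodType K).
Implicit Type F : uea g -> uea g -> Z.

Lemma sweedler_comul1 F : bilinear2 F -> sweedler F (comul 1) = F 1 1.
Proof. by move=> FP; rewrite comul1 (sweedler_tens FP). Qed.

(** [comul] is multiplicative and [uin x] is primitive; the identity then holds with any tensor in
    place of [comul X], so pure tensors suffice. *)
Lemma sweedler_comul_mul_uin F X x : bilinear2 F ->
  sweedler F (comul (X * uin x)) =
  sweedler (fun u v => F (u * uin x) v + F u (v * uin x)) (comul X).
Proof.
move=> FP; set G := (X in _ = sweedler X _).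
have GP : bilinear2 G by apply: bilinear2_coder; last exact: linear_mulr.
rewrite comulM comul_uin; elim/tensor_ind: (comul X) => [|u v|p q IHp IHq].
- by rewrite mul0r (linear_0E (sweedler_linear FP)) (linear_0E (sweedler_linear GP)).
- rewrite mulrDr !tensM !mulr1 (linear_addE (sweedler_linear FP)).
  by rewrite !sweedler_tens.
- by rewrite mulrDl (linear_addE (sweedler_linear FP)) IHp IHq
     (linear_addE (sweedler_linear GP)).
Qed.

(** Compatibility of the coproduct with a primitive acting element, tested against bilinear maps. It
    propagates along words by the Leibniz rule, since the action sends generators to generators. *)
Lemma sweedler_comul_act (a : lieAlgType K) (M : rlieModule g a) F X b :
  bilinear2 F ->
  sweedler F (comul (uact M X (uin b))) =
  sweedler (fun u v => F (uact M u (uin b)) v + F u (uact M v (uin b))) (comul X).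
Proof.
pose act := uact M ^~ (uin b); rewrite -!/(act _).
have actP : linear act by apply: uact_linearl.
have act1 : act 1 = 0 by rewrite /act uact_pi /= uder1.
pose D F := fun u v => F (act u) v + F u (act v).
have DP F' : bilinear2 F' -> bilinear2 (D F').
  by move=> F'P; apply: bilinear2_coder.
(* [F] stays general: for [X * uin x] the induction hypothesis is used at [F] with [uin x]
   multiplied into either slot. *)
rewrite -/(D F); elim/uea_rind: X F => [|c X Y IX IY|X x IX] F FP.
- rewrite act1 (linear_0E (@comul_linear _ _)) (linear_0E (sweedler_linear FP)).
  rewrite sweedler_comul1 /D; last exact: DP.
  by rewrite act1 (linear_0E (proj1 FP 1)) (linear_0E (proj2 FP 1)) addr0.
- have DFP := DP F FP.
  by rewrite actP !comul_linear !sweedler_linear // IX // IY.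
rewrite /act uact_der uact_uin -/(act _).
rewrite (linear_addE (@comul_linear _ _)) (linear_addE (sweedler_linear FP)).
rewrite !sweedler_comul_mul_uin //; last exact: DP.
rewrite IX; last by apply: bilinear2_coder; last exact: linear_mulr.
rewrite -sweedlerD; apply: eq_sweedler => u v.
rewrite /D /act !uact_der !uact_uin -/(act _) -/(act _).
rewrite (linear_addE (proj1 FP v)) (linear_addE (proj2 FP u)) !addrA.
by rewrite (ACl (1*5*3*2*4*6)).
Qed.

End Coproduct.

(** Appending [x] multiplies the sum for [X] by [uin x] on the right and by [- uin x] on the left;
    that sum is a scalar by induction, so the two terms cancel. *)
Lemma antipode_mull (K : fieldType) (g : lieAlgType K) (X : uea g) :
  sweedler (fun u v => antipode u * v) (comul X) = counit X *: 1.
Proof.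
have FP := bilinear2_mul (@antipode_linear K g) (@linear_id K (uea g)).
elim/uea_rind: X => [|c X Y IX IY|X x IX].
- by rewrite sweedler_comul1 // antipode1 counit1 mulr1 scale1r.
- rewrite comul_linear sweedler_linear // IX IY counit_linear.
  by rewrite scalerDl scalerA.
rewrite sweedler_comul_mul_uin // counitM counit_gen mulr0 scale0r.
under eq_sweedler => u v.
  rewrite antipodeM antipode_uin -mulrA [_ * (_ * uin x)]mulrA; over.
rewrite sweedlerD (sweedler_comp _ _ (@linear_mulr _ _ (uin x))) IX.
have mP : linear (fun Y => - uin x * Y : uea g).
  by move=> c Y Z; rewrite mulrDr scalerAr.
by rewrite (sweedler_comp _ _ mP) IX mulr_algl mulr_algr scalerN addNr.
Qed.

(** * The recursion satisfied by a Hopf O-operator *)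

Section HopfOExtension.
Variables (K : fieldType) (g a : lieAlgType K) (M : rlieModule g a).

Lemma uact_1l A : uact M 1 A = counit A *: 1.
Proof.
elim/uea_rind: A => [|c A B IA IB|A b IA].
- by rewrite uact1 counit1 scale1r.
- by rewrite uact_linearr IA IB counit_linear scalerDl scalerA.
rewrite uactA IA (linear_scaleE (uact_linearl M _)) uact_pi /= uder1 scaler0.
by rewrite counitM counit_gen mulr0 scale0r.
Qed.

Variables (t : {linear g -> a}) (T : {linear uea g -> uea a}).
Hypothesis TP : hopf_O_extension M t T.

Lemma bilinear2_Oprod e : bilinear2 (fun u v => T (uact M e (T u) * v)).
Proof.
have uP : linear (fun u => uact M e (T u)).
  by move=> c u v; rewrite linearP uact_linearr.
have [Fl Fr] := bilinear2_mul uP (@linear_id _ (uea g)).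
by split=> [v|u] c x y; rewrite ?Fl ?Fr linearP.
Qed.

(* [T 1] is group-like, hence invertible, and idempotent. *)
Lemma hopf_O_extension1 : T 1 = 1.
Proof.
have [[Tcomul Tcounit Tmul] _] := TP.
have bil (Z : lmodType K) (F : uea a -> uea a -> Z) : bilinear2 F ->
    bilinear2 (fun u v => F (T u) (T v)).
  by move=> FP; apply: (bilinear2_comp FP); apply: linearP.
have idem : T 1 * T 1 = T 1.
  rewrite Tmul sweedler_comul1.
    by rewrite uact_1l Tcounit counit1 scale1r mulr1.
  exact: bilinear2_Oprod.
have glike : comul (T 1) = T 1 ⊗ T 1.
  rewrite Tcomul sweedler_comul1 //; apply: bil.
  by split=> [w|v]; [apply: tens_linearl | apply: tens_linearr].
have inv : antipode (T 1) * T 1 = 1.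
  have := antipode_mull (T 1); rewrite glike Tcounit counit1 scale1r sweedler_tens //.
  exact: (bilinear2_mul (@antipode_linear K a) (@linear_id _ _)).
by rewrite -[LHS]mul1r -inv -mulrA idem.
Qed.

(** The product rule at the primitive element [uin h] has one term per slot; since [T 1 = 1], the
    second is [T (E * uin h)]. *)
Lemma hopf_O_extension_mul_uin E h :
  T (E * uin h) = T E * uin (t h) - T (uact M E (uin (t h))).
Proof.
have [[_ _ Tmul] Tgen] := TP.
rewrite -Tgen Tmul -[uin h]mul1r sweedler_comul_mul_uin; last exact: bilinear2_Oprod.
rewrite (sweedler_comul1 (bilinear2_coder (bilinear2_Oprod E) (@linear_mulr _ _ (uin h)))).
rewrite !mul1r hopf_O_extension1 uact1 mulr1.
by rewrite addrAC subrr add0r.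
Qed.

End HopfOExtension.

(** * The map P_e and the recursion for the hash product *)

Section Twist.
Variables (K : fieldType) (g a : lieAlgType K) (M : rlieModule g a).
Variables (s : {linear g -> a}) (S : {linear uea g -> uea a}).
Hypothesis SP : hopf_O_extension M s S.

(** This is P_e(X) of the overview. *)
Definition twist (e : uea g) (X : uea a) : uea a :=
  sweedler (fun b1 b2 => S (uact M e (antipode b1)) * b2) (comul X).

Lemma bilinear2_twist_body e :
  bilinear2 (fun b1 b2 : uea a => S (uact M e (antipode b1)) * b2).
Proof.
have pP : linear (fun b1 => S (uact M e (antipode b1))).
  by move=> c u v; rewrite antipode_linear uact_linearr linearP.
exact: (bilinear2_mul pP (@linear_id _ (uea a))).
Qed.

Lemma bilinear2_twist : bilinear2 twist.
Proof.
split=> [X|e] c u v.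
  rewrite /twist -sweedler_suml; apply: eq_sweedler => b1 b2.
  by rewrite uact_linearl linearP mulrDl scalerAl.
by rewrite /twist comul_linear sweedler_linear //; apply: bilinear2_twist_body.
Qed.

Lemma twist1 e : twist e 1 = S e.
Proof.
rewrite /twist sweedler_comul1; last exact: bilinear2_twist_body.
by rewrite antipode1 uact1 mulr1.
Qed.

(** In the second slot [b] remains a right factor. In the first, [antipode] reverses products, so
    [- uin b] comes first and acts directly on [e]. *)
Lemma twist_mul_uin e X b :
  twist e (X * uin b) = twist e X * uin b - twist (uact M e (uin b)) X.
Proof.
rewrite /twist sweedler_comul_mul_uin; last exact: bilinear2_twist_body.
rewrite sweedlerD addrC -sweedlerN -(sweedler_comp _ _ (@linear_mulr _ _ (uin b))).
congr (_ + _); apply: eq_sweedler => u v; first by rewrite mulrA.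
rewrite antipodeM antipode_uin mulNr (linear_oppE (uact_linearr M e)) linearN.
by rewrite uactA mulNr.
Qed.

Let twistDl X : {morph twist^~ X : e f / e + f} :=
  linear_addE (proj1 bilinear2_twist X).
Let twistNl X : {morph twist^~ X : e / - e} :=
  linear_oppE (proj1 bilinear2_twist X).
Let twistDr e : {morph twist e : e f / e + f} :=
  linear_addE (proj2 bilinear2_twist e).
Let twistNr e : {morph twist e : e / - e} :=
  linear_oppE (proj2 bilinear2_twist e).

Variables (t : {linear g -> a}) (T : {linear uea g -> uea a}).
Hypothesis TP : hopf_O_extension M t T.
Hypothesis st : forall x y, lie (s x) (t y) = s (M x (t y)) - t (M y (s x)).

(** For a word f y, the recursion of [T] and [twist_mul_uin] carry t(y) outside or onto [e] and [f].
    The induction hypotheses then leave commutators of s(h) and t(y), which the matching condition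
    resolves. As t(y) also acts on e h, the induction must leave [e] and [h] free. *)
Lemma twist_mull_uin e h f :
  twist (e * uin h) (T f) =
  twist e (T f) * uin (s h) - twist (uact M e (uin (s h))) (T f)
  - twist e (T (uact M f (uin (s h)))).
Proof.
elim/(@uea_act_ind _ _ _ M): f e h => [|c f f' If If'|f y If Ifb] e h.
(* At f = 1 the last term vanishes, as derivations kill 1, and the recursion of [S] remains. *)
- rewrite (hopf_O_extension1 TP) !twist1 uact_1l counit_gen scale0r linear0.
  by rewrite (linear_0E (proj2 bilinear2_twist e)) subr0 (hopf_O_extension_mul_uin SP).
- rewrite uact_linearl !linearP !(proj2 bilinear2_twist) If If'.
  rewrite mulrDl -scalerAl !scalerBr !opprD !addrA.
  by rewrite [RHS](ACl (1*3*5*2*4*6)).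
have hop := hopf_O_extension_mul_uin TP.
(* The matching condition inside U(a), used to put t(y) before s(h) among the right factors and, via
   [actE], in the successive actions on [e] and [f]. *)
have stE : uin (s h) * uin (t y) =
    uin (t y) * uin (s h) + uin (s (M h (t y))) - uin (t (M y (s h))).
  by rewrite -addrA -[_ - _](linearB (@uin K a)) -st /= uin_lie addrC subrK.
have TD : {morph T : X Y / X + Y} by exact: linearD.
have TN : {morph T : X / - X} by exact: linearN.
rewrite uact_der uact_uin TD !hop.
rewrite !twistDr !twistNr !twist_mul_uin uact_der uact_uin twistDl.
rewrite !If !Ifb.
rewrite -!uactA.
have actE X : uact M X (uin (s h) * uin (t y)) = uact M X (uin (t y) * uin (s h))
   + uact M X (uin (s (M h (t y)))) - uact M X (uin (t (M y (s h)))).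
  by rewrite stE (linear_subE (uact_linearr M _)) (linear_addE (uact_linearr M _)).
rewrite !actE.
rewrite !TD !TN.
rewrite !(twistDr, twistNr, twistDl, twistNl).
rewrite !(mulrDl, mulrDr, mulNr, mulrN) -!mulrA.
rewrite !stE !(mulrDr, mulrN).
rewrite !(opprD, opprK) !addrA.
(* The parenthesised pairs of opposite terms cancel, one here and two on the right; the other twelve
   terms are aligned. *)
rewrite [LHS](ACl ((2*9)*1*6*12*4*7*10*13*5*8*14*11*3)) /= subrr add0r.
rewrite [RHS](ACl ((7*15)*(13*16)*1*2*3*4*5*6*8*9*10*11*12*14)) /=.
by rewrite !addNr !add0r.
Qed.

Lemma bilinear2_hash_body : bilinear2 (fun f1 f2 => twist f1 (T f2)).
Proof. exact: bilinear2_comp bilinear2_twist (@linear_id _ _) (linearP T). Qed.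

Lemma hash1 : hash M S T 1 = 1.
Proof.
rewrite /hash (sweedler_comul1 bilinear2_hash_body).
by rewrite (hopf_O_extension1 TP) twist1 (hopf_O_extension1 SP).
Qed.

Lemma hash_linear : linear (hash M S T).
Proof.
move=> c X Y; rewrite /hash comul_linear.
exact: (sweedler_linear bilinear2_hash_body).
Qed.

(** With h in the first slot, [twist_mull_uin] gives the s-part; in the second, the recursion of [T]
    and [twist_mul_uin] give the t-part. Each part acts on both slots, which [sweedler_comul_act]
    reassembles into an action on [E]. *)
Lemma hash_mul_uin E h :
  hash M S T (E * uin h) =
  hash M S T E * uin (s h + t h) - hash M S T (uact M E (uin (s h + t h))).
Proof.
have FP := bilinear2_hash_body.
rewrite [LHS](sweedler_comul_mul_uin E h FP) [X in _ - X](sweedler_comul_act M E _ FP).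
rewrite -(sweedler_comp _ _ (@linear_mulr _ _ (uin (s h + t h)))) -sweedlerN -sweedlerD.
apply: eq_sweedler => u v.
rewrite twist_mull_uin (hopf_O_extension_mul_uin TP) twistDr twistNr twist_mul_uin.
rewrite [uin (_ + _)](linearD (@uin K a)) /= !(linear_addE (uact_linearr M _)).
rewrite [T (_ + _)](linearD T) /= twistDl twistDr mulrDr !opprD !addrA.
by rewrite [LHS](ACl (1*4*2*5*3*6)).
Qed.

End Twist.

(** * Uniqueness of the solution and symmetry in the two operators *)

(** Both sides obey one recursion with value 1 at 1. It calls on the image of [X] under the action,
    not a shorter word in general, whence [uea_act_ind]. *)
Lemma hopf_O_extension_add_hash (K : fieldType) (g a : lieAlgType K)
    (M : rlieModule g a) (s t : {linear g -> a})
    (S T ST : {linear uea g -> uea a}) :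
  hopf_O_extension M s S -> hopf_O_extension M t T ->
  (forall x y, lie (s x) (t y) = s (M x (t y)) - t (M y (s x))) ->
  hopf_O_extension M (s \+ t) ST -> ST =1 hash M S T.
Proof.
move=> SP TP st STP; elim/(@uea_act_ind _ _ _ M) => [|c X Y IX IY|X x IX IXb].
- by rewrite (hopf_O_extension1 STP) (hash1 SP TP).
- by rewrite linearP hash_linear IX IY.
- by rewrite (hopf_O_extension_mul_uin STP) (hash_mul_uin SP TP st) IX IXb.
Qed.

Theorem theorem4p3p1 (K : fieldType) (charK0 : [pchar K] =i pred0)
    (g a : lieAlgType K) (M : rlieModule g a) (s t : {linear g -> a})
    (Hst : matching_lie_O_operator M s t)
    (S T ST : {linear uea g -> uea a})
    (HS : hopf_O_extension M s S)
    (HT : hopf_O_extension M t T)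
    (HST : hopf_O_extension M (s \+ t) ST) :
  ST =1 hash M S T /\ hash M S T =1 hash M T S.
Proof.
have [_ _ st] := Hst.
have lieC (L : lieAlgType K) (x y : L) : lie x y = - lie y x.
  have lD : forall u v w : L, lie (u + v) w = lie u w + lie v w.
    by move=> u v w; apply: (linear_addE (lie_linearl w)).
  apply/eqP; rewrite -addr_eq0; apply/eqP.
  have := liexx (x + y); rewrite lD !(linear_addE (lie_linearr _)) !liexx.
  by rewrite addr0 add0r.
(* Antisymmetry turns the mixed condition into the one for the swapped pair, so both hash products
   equal [ST]. *)
have ts x y : lie (t x) (s y) = t (M x (s y)) - s (M y (t x)).
  by rewrite lieC st opprB.
have HTS : hopf_O_extension M (t \+ s) ST.
  by case: HST => HO Hgen; split=> // x; rewrite Hgen /= addrC.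
have STE := hopf_O_extension_add_hash HS HT st HST; split=> // X.
by rewrite -STE; exact: (hopf_O_extension_add_hash HT HS ts HTS).
Qed.
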